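(* If an $m\times n$ discrete conjugate net in $\mathbb{R}^3$ has no pair of coplanar adjacent faces and all of its $3\times 3$-subnets are infinitesimally flexible, then the net is infinitesimally flexible as a whole.
   Context: An $m\times n$ discrete conjugate net is a polyhedral surface in $\mathbb{R}^3$ with planar quadrilateral faces connected in the combinatorics of an $m\times n$ square grid of faces: it is given by points $p_{i,j}\in\mathbb{R}^3$, $0\le i\le m$, $0\le j\le n$, such that for all $1\le i\le m$, $1\le j\le n$ the points $p_{i-1,j-1},p_{i-1,j},p_{i,j},p_{i,j-1}$ are, in this cyclic order, the vertices of a planar quadrilateral (a face). Two faces are adjacent if they share an edge of the grid; adjacent faces are coplanar if they lie in a common plane. A $3\times 3$-subnet is the net formed by the faces in three consecutive rows and three consecutive columns. An infinitesimal isometry of $\mathbb{R}^3$ is a vector field of the form $\xi(x)=Ax+b$ with a skew-symmetric matrix $A$ or, equivalently, $\xi(x)=r\times x+b$ with $r,b\in\mathbb{R}^3$. An infinitesimal isometric deformation of a polyhedral surface is an assignment of an infinitesimal isometry to every face of the surface such that their restrictions to common edges agree. It is trivial if the infinitesimal isometries of all faces are the same. A polyhedral surface is infinitesimally flexible if it admits a non-trivial infinitesimal isometric deformation.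
   Formalization: The net is assumed to have at least two faces (a single 1×1 face meets the hypotheses vacuously but has only trivial deformations), and a planar quadrilateral is taken to have no three collinear vertices (with straight angles the claim can fail). *)

(* Defs.v *)
From mathcomp Require Import all_boot all_order all_algebra.
From mathcomp Require Import reals.
Set Implicit Arguments.
Unset Strict Implicit.
Unset Printing Implicit Defensive.
Import Order.TTheory GRing.Theory Num.Theory.
Local Open Scope ring_scope.

Notation point R := 'cV[R]_3.

Section Nets.
Variable R : realType.

Definition collinear (s : seq (point R)) : Prop :=
  exists a d : point R,
    d != 0 /\ forall x, x \in s -> exists t : R, x = a + t *: d.

Definition coplanar (s : seq (point R)) : Prop :=
  exists (u : 'rV[R]_3) (c : R),
    u != 0 /\ forall x, x \in s -> (u *m x) 0 0 = c.

(* [q] lists the vertices in cyclic order. Since repeated vertices make a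
   sublist of size 3 collinear, the four vertices are pairwise distinct.
   Convexity and simplicity are not required. *)
Definition planar_quadrilateral (q : seq (point R)) : Prop :=
  [/\ size q = 4%N,
      coplanar q &
      forall s, subseq s q -> size s = 3%N -> ~ collinear s].

(* An m x n net is a map on nat x nat of which only the values at (i, j) with
   i <= m and j <= n matter; the face (i, j), for i < m and j < n, is the one
   with corners (i, j) and (i.+1, j.+1). *)
Definition face (p : nat -> nat -> point R) (i j : nat) : seq (point R) :=
  [:: p i j; p i j.+1; p i.+1 j.+1; p i.+1 j].

Definition conjugate_net (m n : nat) (p : nat -> nat -> point R) : Prop :=
  forall i j, (i < m)%N -> (j < n)%N -> planar_quadrilateral (face p i j).

Definition no_coplanar_adjacent_faces (m n : nat)
    (p : nat -> nat -> point R) : Prop :=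
  (forall i j, (i.+1 < m)%N -> (j < n)%N ->
     ~ coplanar (face p i j ++ face p i.+1 j)) /\
  (forall i j, (i < m)%N -> (j.+1 < n)%N ->
     ~ coplanar (face p i j ++ face p i j.+1)).

Definition subnet (a b : nat) (p : nat -> nat -> point R) :
    nat -> nat -> point R :=
  fun i j => p (a + i)%N (b + j)%N.

Definition infinitesimal_isometry (xi : point R -> point R) : Prop :=
  exists (A : 'M[R]_3) (b : point R),
    A^T = - A /\ forall x, xi x = A *m x + b.

Definition agree_on_segment (xi zeta : point R -> point R)
    (a b : point R) : Prop :=
  forall t : R, 0 <= t <= 1 ->
    xi ((1 - t) *: a + t *: b) = zeta ((1 - t) *: a + t *: b).

Definition infinitesimal_isometric_deformation (m n : nat)
    (p : nat -> nat -> point R)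
    (xi : nat -> nat -> point R -> point R) : Prop :=
  [/\ forall i j, (i < m)%N -> (j < n)%N -> infinitesimal_isometry (xi i j),
      forall i j, (i.+1 < m)%N -> (j < n)%N ->
        agree_on_segment (xi i j) (xi i.+1 j) (p i.+1 j) (p i.+1 j.+1) &
      forall i j, (i < m)%N -> (j.+1 < n)%N ->
        agree_on_segment (xi i j) (xi i j.+1) (p i j.+1) (p i.+1 j.+1)].

Definition trivial_deformation (m n : nat)
    (xi : nat -> nat -> point R -> point R) : Prop :=
  forall i j k l, (i < m)%N -> (j < n)%N -> (k < m)%N -> (l < n)%N ->
    xi i j =1 xi k l.

Definition infinitesimally_flexible (m n : nat)
    (p : nat -> nat -> point R) : Prop :=
  exists xi, infinitesimal_isometric_deformation m n p xi /\
             ~ trivial_deformation m n xi.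

End Nets.

(* Main.v *)
(* Across a shared edge, the rotation vectors of two adjacent faces differ by a
   multiple of the edge vector, and the translations are then determined.
   Closing up around the interior vertices turns deformations modulo trivial
   ones into self-stresses: edge weights in equilibrium at each interior vertex.
   Since no adjacent faces are coplanar, any three of the four edges at such a
   vertex are linearly independent, so its equilibrium weights are unique up to
   scale and all nonzero. A self-stress thus amounts to a choice of one scale
   per interior vertex, with prescribed ratios between neighbouring vertices.
   These ratios are consistent around a face exactly when the 3 x 3 subnet
   centred at it is flexible, and the grid of interior vertices is simply
   connected. *)
Require Import Defs.
From HB Require Import structures.
From mathcomp Require Import all_boot all_order all_algebra.
From mathcomp Require Import boolp reals zify ring lra.
Set Implicit Arguments.
Unset Strict Implicit.
Unset Printing Implicit Defensive.
Import Order.TTheory GRing.Theory Num.Theory.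
Local Open Scope ring_scope.

(** [s] follows the side [j = 0] with [F], then goes inwards with [G]; commutation on each unit
    square carries the rule for [F] from one [j] to the next. It serves twice: to integrate a stress
    over the faces, and to spread scales over the interior vertices. *)
Lemma grid_transport (T : Type) (m n : nat) (F G : nat -> nat -> T -> T)
    (t0 : T) :
  (forall i j, (i.+1 < m)%N -> (j.+1 < n)%N ->
     G i.+1 j \o F i j =1 F i j.+1 \o G i j) ->
  exists s : nat -> nat -> T,
    [/\ s 0%N 0%N = t0,
        forall i j, (i.+1 < m)%N -> (j < n)%N -> s i.+1 j = F i j (s i j) &
        forall i j, (i < m)%N -> (j.+1 < n)%N -> s i j.+1 = G i j (s i j)].
Proof.
move=> FG.
pose row := fix row i := if i is i'.+1 then F i' 0%N (row i') else t0.
pose s := fix s i j := if j is j'.+1 then G i j' (s i j') else row i.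
exists s; split=> // i j lt_i; elim: j => [//|j IHj] lt_j /=.
by rewrite IHj ?(ltnW lt_j) //; apply: FG.
Qed.

(** * Cross product matrices *)

Section CrossProduct.
Variable R : realFieldType.
Implicit Types (d r x : 'cV[R]_3) (a : R).

(* [cross_mx d *m x] is the cross product of [d] and [x]. *)
Definition cross_mx d : 'M[R]_3 :=
  \matrix_(i, j) nth 0 (nth [::] [:: [:: 0; - d 2%:R 0; d 1 0];
                                     [:: d 2%:R 0; 0; - d 0 0];
                                     [:: - d 1 0; d 0 0; 0]] i) j.

Lemma ord3P (P : 'I_3 -> Prop) : P 0 -> P 1 -> P 2%:R -> forall i, P i.
Proof.
move=> P0 P1 P2 [[|[|[|//]]] lti].
- by rewrite (_ : Ordinal _ = 0) //; apply: val_inj.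
- by rewrite (_ : Ordinal _ = 1) //; apply: val_inj.
- by rewrite (_ : Ordinal _ = 2%:R) //; apply: val_inj.
Qed.

Lemma sum3E (V : zmodType) (f : 'I_3 -> V) : \sum_i f i = f 0 + f 1 + f 2%:R.
Proof.
rewrite !big_ord_recl big_ord0 addr0 addrA.
by congr (f _ + f _ + f _); apply: val_inj.
Qed.

Lemma cross_mx_is_linear : linear cross_mx.
Proof.
move=> a d r; apply/matrixP.
by apply: ord3P; apply: ord3P; rewrite !mxE /=; ring.
Qed.

HB.instance Definition _ :=
  GRing.isLinear.Build R 'cV[R]_3 'M[R]_3 *:%R cross_mx cross_mx_is_linear.

Lemma tr_cross_mx d : (cross_mx d)^T = - cross_mx d.
Proof.
by apply/matrixP; apply: ord3P; apply: ord3P; rewrite !mxE /= ?opprK ?oppr0.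
Qed.

Lemma cross_mx_self d : cross_mx d *m d = 0.
Proof.
by apply/matrixP; apply: ord3P => j; rewrite ord1 !mxE sum3E !mxE /=; ring.
Qed.

Lemma skew_cross_mx (A : 'M[R]_3) : A^T = - A -> exists r, A = cross_mx r.
Proof.
move/matrixP=> skewA; exists (\col_i nth 0 [:: A 2%:R 1; A 0 2%:R; A 1 0] i).
have skew i j : A i j = - A j i by have := skewA j i; rewrite !mxE.
have diag i : A i i = 0 by have := skew i i; lra.
apply/matrixP; apply: ord3P; apply: ord3P; rewrite !mxE //= ?diag //.
Qed.

Lemma cross_mx_eq0 r d : d != 0 -> cross_mx r *m d = 0 -> exists a, r = a *: d.
Proof.
move=> nzd /matrixP rd.
have := rd 0 0; have := rd 1 0; have := rd 2%:R 0.
rewrite !mxE !sum3E !mxE /= => r2 r1 r0.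
have [i nzdi] : exists i, d i 0 != 0.
  apply/existsP; apply: contraNT nzd; rewrite negb_exists => /forallP d0.
  apply/eqP/matrixP=> i j; rewrite ord1 !mxE; apply/eqP.
  by have := d0 i; rewrite negbK.
(* The factor is read off at a nonzero coordinate of [d]; the vanishing components of the cross
   product give the other coordinates. *)
exists (r i 0 / d i 0); apply/matrixP=> j k; rewrite ord1 !mxE {k}.
apply: (mulIf nzdi); rewrite mulrAC divfK //.
move: i j {nzdi}; apply: ord3P; apply: ord3P; lra.
Qed.

Lemma cross_mx_inj : injective cross_mx.
Proof.
move=> d r /matrixP dr; apply/matrixP.
have := dr 2%:R 1; have := dr 0 2%:R; have := dr 1 0; rewrite !mxE /=.
by move=> d2 d1 d0; apply: ord3P => j; rewrite ord1.
Qed.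

End CrossProduct.

(** * Linear relations among vectors of three-space *)

Section Independence.
Variable F : fieldType.
Implicit Types (a b c d : 'cV[F]_3) (u : 'rV[F]_3).

Definition independent3 a b c :=
  forall x y z : F, x *: a + y *: b + z *: c = 0 -> [/\ x = 0, y = 0 & z = 0].

Let cols a b c : 'M[F]_3 := \matrix_(i, j) nth 0 [:: a; b; c] j i 0.

Lemma cols_mul a b c (w : 'cV[F]_3) :
  cols a b c *m w = w 0 0 *: a + w 1 0 *: b + w 2%:R 0 *: c.
Proof.
apply/matrixP=> i j; rewrite ord1 !mxE !big_ord_recl big_ord0 !mxE /=.
rewrite addr0 addrA ![_ * w _ _]mulrC.
by congr (w _ _ * _ + w _ _ * _ + w _ _ * _); apply: val_inj.
Qed.

Lemma mul_cols a b c u :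
  reflect [/\ u *m a = 0, u *m b = 0 & u *m c = 0] (u *m cols a b c == 0).
Proof.
have E (j : 'I_3) : (u *m cols a b c) 0 j = (u *m nth 0 [:: a; b; c] j) 0 0.
  by rewrite !mxE; apply: eq_bigr => k _; rewrite mxE.
apply: (iffP eqP) => [/matrixP uM | [ua ub uc]].
  by split; apply/matrixP=> i j; rewrite !ord1;
    [have := uM 0 0 | have := uM 0 1 | have := uM 0 2%:R]; rewrite E !mxE.
apply/matrixP=> i j; rewrite ord1 E [RHS]mxE; case: j => [[|[|[|//]]]] /= _;
  by rewrite ?ua ?ub ?uc mxE.
Qed.

Lemma independent3PnN a b c :
  ~ independent3 a b c ->
  exists u, [/\ u != 0, u *m a = 0, u *m b = 0 & u *m c = 0].
Proof.
have [/det0P[u nzu /eqP/mul_cols[ua ub uc]] _ | nzdet []] :=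
  boolP (\det (cols a b c) == 0); first by exists u.
have uM : cols a b c \in unitmx by rewrite unitmxE unitfE.
move=> x y z xyz; pose w : 'cV[F]_3 := \col_i nth 0 [:: x; y; z] i.
have w0 : w = 0.
  by rewrite -(mulKmx uM w) cols_mul !mxE /= xyz mulmx0.
by split; [have := congr1 (fun v : 'cV_3 => v 0 0) w0
         | have := congr1 (fun v : 'cV_3 => v 1 0) w0
         | have := congr1 (fun v : 'cV_3 => v 2%:R 0) w0]; rewrite !mxE.
Qed.

(** A square matrix and its transpose have the same determinant, so a nonzero left kernel vector
    forces a nonzero right one. *)
Lemma annihilated_dependent3 a b c u :
    u != 0 -> u *m a = 0 -> u *m b = 0 -> u *m c = 0 ->
  exists x y z, x *: a + y *: b + z *: c = 0 /\ ~ [/\ x = 0, y = 0 & z = 0].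
Proof.
move=> nzu ua ub uc.
have : \det (cols a b c)^T == 0.
  by rewrite det_tr; apply/det0P; exists u => //; apply/eqP/mul_cols.
case/det0P=> w nzw /(congr1 trmx); rewrite trmx_mul trmxK trmx0 cols_mul.
rewrite !mxE => w0; exists (w 0 0), (w 0 1), (w 0 2%:R); split=> // -[w00 w01 w02].
case/eqP: nzw; apply/matrixP=> i; rewrite ord1.
by apply: (@ord3P (fun j => w 0 j = _ 0 j)); rewrite mxE.
Qed.

Lemma independent3_span a b c d :
  independent3 a b c -> exists x y z, x *: a + y *: b + z *: c = d.
Proof.
move=> ind; have uM : cols a b c \in unitmx.
  rewrite unitmxE unitfE; apply/negP => /det0P[u nzu /eqP/mul_cols[ua ub uc]].
  have [x [y [z [/ind]]]] := annihilated_dependent3 nzu ua ub uc.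
  by [].
pose w := invmx (cols a b c) *m d.
by exists (w 0 0), (w 1 0), (w 2%:R 0); rewrite -cols_mul mulKVmx.
Qed.

Lemma independent3_rev a b c : independent3 a b c -> independent3 c b a.
Proof.
move=> abc x y z; rewrite addrC [_ + y *: _]addrC addrA.
by case/abc.
Qed.

(** Expanding [- d] in the basis [a], [b], [c] gives a relation with last coefficient 1. A zero
    coefficient would leave a relation among three independent vectors. Subtracting [t'] times this
    relation from any other leaves one among [a], [b], [c]. *)
Lemma unique_relation4 a b c d :
    independent3 a b c -> independent3 b c d -> independent3 c d a ->
    independent3 d a b ->
  exists q : F * F * F * F, let: (x, y, z, t) := q in
    [/\ [/\ x != 0, y != 0, z != 0 & t != 0],
        x *: a + y *: b + z *: c + t *: d = 0 &
        forall x' y' z' t', x' *: a + y' *: b + z' *: c + t' *: d = 0 ->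
          exists s, [/\ x' = s * x, y' = s * y, z' = s * z & t' = s * t]].
Proof.
move=> abc bcd cda dab.
have [x [y [z xyz]]] := independent3_span (- d) abc.
have rel : x *: a + y *: b + z *: c + 1 *: d = 0 by rewrite xyz scale1r addNr.
have nz1 := oner_eq0 F.
exists (x, y, z, 1); split=> //.
  split=> //; apply/eqP=> e; move: rel; rewrite e scale0r ?add0r ?addr0.
  - by case/bcd=> _ _ /eqP; rewrite nz1.
  - by rewrite -addrA addrC => /cda[_ /eqP]; rewrite nz1.
  - by rewrite addrC addrA => /dab[/eqP]; rewrite nz1.
  - by move/eqP: e; rewrite nz1.
move=> x' y' z' t' rel'; exists t'.
have [|x0 y0 z0] := abc (x' - t' * x) (y' - t' * y) (z' - t' * z).
  rewrite !scalerBl -!scalerA.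
  transitivity (x' *: a + y' *: b + z' *: c - t' *: (x *: a + y *: b + z *: c)).
    by apply/matrixP=> i j; rewrite !mxE; ring.
  by rewrite xyz scalerN opprK.
by split; try (by apply/eqP; rewrite -subr_eq0; apply/eqP); rewrite mulr1.
Qed.

End Independence.

(** * Self-stresses and their correspondence with deformations *)

Section SelfStress.
Variable R : realType.
Implicit Types (p : nat -> nat -> 'cV[R]_3) (h k : nat -> nat -> R).

(* [h i j] is the weight of the edge shared by the faces (i, j) and (i, j.+1),
   and [k i j] that of the edge shared by the faces (i, j) and (i.+1, j). *)
Definition self_stress (m n : nat) p h k : Prop :=
  forall i j, (i.+1 < m)%N -> (j.+1 < n)%N ->
    let v := p i.+1 j.+1 in
    h i j *: (p i j.+1 - v) + k i j *: (p i.+1 j - v)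
      + h i.+1 j *: (p i.+2 j.+1 - v) + k i j.+1 *: (p i.+1 j.+2 - v) = 0.

Definition nonzero_stress (m n : nat) h k : Prop :=
  (exists i j, [/\ (i < m)%N, (j.+1 < n)%N & h i j != 0]) \/
  (exists i j, [/\ (i.+1 < m)%N, (j < n)%N & k i j != 0]).

Lemma subnet_conjugate_net m n m' n' a b p :
    conjugate_net m n p -> (a + m' <= m)%N -> (b + n' <= n)%N ->
  conjugate_net m' n' (subnet a b p).
Proof.
move=> net le_m le_n i j lti ltj.
have := net (a + i)%N (b + j)%N; rewrite /face /subnet !addnS; apply; lia.
Qed.

Lemma linear_dependence_collinear (v a b : 'cV[R]_3) (x y : R)
    (s : seq 'cV[R]_3) :
    x *: (a - v) + y *: (b - v) = 0 -> (x != 0) || (y != 0) ->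
  {subset s <= [:: v; a; b]} -> collinear s.
Proof.
wlog nzx : a b x y / x != 0 => [wl rel nzxy sub | rel _ sub].
  have [x0|nzx] := eqVneq x 0; last exact: (wl a b x y).
  apply: (wl b a y x) => //; first by case/orP: nzxy; rewrite ?x0 ?eqxx.
  - by rewrite addrC.
  - by rewrite orbC.
  by move=> z /sub; rewrite !inE => /or3P[]->; rewrite ?orbT.
have av : a - v = - (x^-1 * y) *: (b - v).
  apply: (scalerI nzx); rewrite scalerA mulrN mulVKf // scaleNr.
  by apply/eqP; rewrite -addr_eq0 rel.
(* [collinear] asks for a nonzero direction; if [b = v] then also [a = v], and any direction will
   do. *)
pose d := if b == v then const_mx 1 else b - v.
have nzd : d != 0.
  rewrite /d; case: (b =P v) => [_|/eqP]; last by rewrite subr_eq0.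
  by apply/eqP=> /matrixP/(_ 0 0)/eqP; rewrite !mxE oner_eq0.
have [u bv] : exists u, b - v = u *: d.
  rewrite /d; case: (b =P v) => [->|_]; last by exists 1; rewrite scale1r.
  by exists 0; rewrite subrr scale0r.
exists v, d; split=> // z /sub; rewrite !inE => /or3P[]/eqP->.
- by exists 0; rewrite scale0r addr0.
- exists (- (x^-1 * y) * u); rewrite -scalerA -bv -av; exact/esym/subrKC.
- by exists u; rewrite -bv; exact/esym/subrKC.
Qed.

(** Affine maps agree on a segment as soon as they agree at its ends; the two conditions are the
    difference of the maps along [v - u] and at [u]. *)
Lemma agree_on_segmentP (xi zeta : 'cV[R]_3 -> 'cV[R]_3)
    (A A' : 'M[R]_3) (b b' u v : 'cV[R]_3) :
    (forall x, xi x = A *m x + b) -> (forall x, zeta x = A' *m x + b') ->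
  agree_on_segment xi zeta u v <->
  (A' - A) *m (v - u) = 0 /\ b' - b = - ((A' - A) *m u).
Proof.
move=> xiE zetaE; split=> [agree | [uv bb] t _].
  have /agree : 0 <= (0 : R) <= 1 by rewrite lexx ler01.
  have /agree : 0 <= (1 : R) <= 1 by rewrite lexx ler01.
  rewrite subrr subr0 !scale0r !scale1r add0r addr0 !xiE !zetaE => eqv equ.
  rewrite mulmxBr !mulmxBl; move: (A *m u) (A *m v) (A' *m u) (A' *m v) equ eqv.
  move=> x y x' y' /matrixP equ /matrixP eqv.
  by split; apply/matrixP=> i j; move: (equ i j) (eqv i j); rewrite !mxE; lra.
apply/esym/eqP; rewrite -subr_eq0 xiE zetaE.
have -> : (1 - t) *: u + t *: v = u + t *: (v - u).
  by apply/matrixP=> i j; rewrite !mxE; ring.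
rewrite opprD addrACA -mulmxBl bb mulmxDr -scalemxAr uv scaler0 addr0.
by rewrite subrr.
Qed.

(** The permutation lets [v] come first and its companions in either order, whereas
    [planar_quadrilateral] only speaks of sublists in list order. *)
Definition corner (q : seq 'cV[R]_3) (v x y : 'cV[R]_3) : Prop :=
  exists2 s, subseq s q & perm_eq s [:: v; x; y].

Lemma corner_free q v x y (a b : R) :
    planar_quadrilateral q -> corner q v x y ->
  a *: (x - v) + b *: (y - v) = 0 -> a = 0 /\ b = 0.
Proof.
case=> _ _ ncol [s sub_sq s_vxy] rel.
have [/eqP a0|nza] := boolP (a == 0); have [/eqP b0|nzb] := boolP (b == 0) => //;
  case: (ncol s); rewrite ?(perm_size s_vxy) //;
  by apply: (linear_dependence_collinear rel); rewrite ?nza ?nzb ?orbT // => z;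
     rewrite (perm_mem s_vxy).
Qed.

Lemma corner_neq q v x y :
  planar_quadrilateral q -> corner q v x y -> x != v.
Proof.
move=> plane_q cq; apply/eqP=> xv.
have [|/eqP] := corner_free (a := 1) (b := 0) plane_q cq.
  by rewrite xv subrr scaler0 scale0r addr0.
by rewrite oner_eq0.
Qed.

(** The vertices lie in one plane and [v], [x], [y] are not collinear, so [z - v] is a combination
    of [x - v] and [y - v]. *)
Lemma corner_annihilator q v x y z (u : 'rV[R]_3) :
    planar_quadrilateral q -> corner q v x y -> z \in q ->
  u *m (x - v) = 0 -> u *m (y - v) = 0 -> u *m (z - v) = 0.
Proof.
move=> plane_q cq zq ux uy; have [_ [u0 [c [nzu0 u0q]]] _] := plane_q.
have [s sub_sq s_vxy] := cq.
have in_q t : t \in [:: v; x; y] -> t \in q.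
  by rewrite -(perm_mem s_vxy); apply: mem_subseq.
have kill t : t \in q -> u0 *m (t - v) = 0.
  move=> tq; apply/matrixP=> i j; rewrite !ord1 mulmxBr [LHS]mxE [X in _ + X]mxE.
  by rewrite !u0q ?subrr ?mxE // in_q // inE eqxx.
have kx : u0 *m (x - v) = 0 by rewrite kill ?in_q // !inE eqxx ?orbT.
have ky : u0 *m (y - v) = 0 by rewrite kill ?in_q // !inE eqxx ?orbT.
have [a [b [d [rel nz]]]] := annihilated_dependent3 nzu0 kx ky (kill z zq).
have [d0|nzd] := eqVneq d 0.
  case: nz; move: rel; rewrite d0 scale0r addr0 => rel.
  by have [-> ->] := corner_free plane_q cq rel.
have : u *m (d *: (z - v)) = 0.
  rewrite (_ : d *: (z - v) = - (a *: (x - v) + b *: (y - v))).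
    by rewrite mulmxN mulmxDr -!scalemxAr ux uy !scaler0 addr0 oppr0.
  by apply/eqP; rewrite -addr_eq0 addrC rel.
by rewrite -scalemxAr => /eqP; rewrite scaler_eq0 (negbTE nzd) => /eqP.
Qed.

(** A nonzero [u] annihilating the three differences would be constant on both faces, which would
    then be coplanar. *)
Lemma adjacent_independent3 q1 q2 v x y z :
    planar_quadrilateral q1 -> planar_quadrilateral q2 ->
    ~ coplanar (q1 ++ q2) -> corner q1 v x y -> corner q2 v y z ->
  independent3 (x - v) (y - v) (z - v).
Proof.
move=> plane1 plane2 nplane c1 c2; apply: contrapT => /independent3PnN.
move=> [u [nzu ux uy uz]]; apply: nplane; exists u, ((u *m v) 0 0); split=> // t.
rewrite mem_cat => tq; suff /eqP : u *m (t - v) = 0.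
  by rewrite mulmxBr subr_eq0 => /eqP->.
by case/orP: tq => tq;
  [apply: corner_annihilator c1 tq ux uy | apply: corner_annihilator c2 tq uy uz].
Qed.

Lemma face_corners (a b c d : 'cV[R]_3) (q := [:: a; b; c; d]) :
  [/\ corner q a b d, corner q b a c, corner q c b d & corner q d a c].
Proof.
split; [exists [:: a; b; d] | exists [:: a; b; c] | exists [:: b; c; d]
       | exists [:: a; c; d]].
- by apply/subseqP; exists [:: true; true; false; true].
- by [].
- by apply/subseqP; exists [:: true; true; true; false].
- by apply/permP=> P /=; lia.
- by apply/subseqP; exists [:: false; true; true; true].
- by apply/permP=> P /=; lia.
- by apply/subseqP; exists [:: true; false; true; true].
- by apply/permP=> P /=; lia.
Qed.

Lemma cornerC q v x y : corner q v x y -> corner q v y x.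
Proof.
by case=> s sub_sq s_vxy; exists s => //; rewrite (permPl s_vxy);
   apply/permP=> P /=; lia.
Qed.

(* [c] lists the coefficients of the edges at [p i.+1 j.+1] in the order in
   which [self_stress] sums over them. *)
Definition vertex_relation p i j (c : R * R * R * R) : Prop :=
  let v := p i.+1 j.+1 in let: (w, s, e, t) := c in
  [/\ [/\ w != 0, s != 0, e != 0 & t != 0],
      w *: (p i j.+1 - v) + s *: (p i.+1 j - v)
        + e *: (p i.+2 j.+1 - v) + t *: (p i.+1 j.+2 - v) = 0 &
      forall w' s' e' t',
        w' *: (p i j.+1 - v) + s' *: (p i.+1 j - v)
          + e' *: (p i.+2 j.+1 - v) + t' *: (p i.+1 j.+2 - v) = 0 ->
        exists l, [/\ w' = l * w, s' = l * s, e' = l * e & t' = l * t]].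

(** The four edges are listed cyclically around the vertex, so any three consecutive ones belong to
    two adjacent faces. *)
Lemma interior_vertex_relation m n p i j :
    conjugate_net m n p -> no_coplanar_adjacent_faces m n p ->
    (i.+1 < m)%N -> (j.+1 < n)%N ->
  exists c, vertex_relation p i j c.
Proof.
move=> net [adj1 adj2] lt_i lt_j.
have lt_i' := ltnW lt_i; have lt_j' := ltnW lt_j.
have [_ _ c00 _] := face_corners (p i j) (p i j.+1) (p i.+1 j.+1) (p i.+1 j).
have [_ c10 _ _] := face_corners (p i.+1 j) (p i.+1 j.+1) (p i.+2 j.+1) (p i.+2 j).
have [c11 _ _ _] :=
  face_corners (p i.+1 j.+1) (p i.+1 j.+2) (p i.+2 j.+2) (p i.+2 j.+1).
have [_ _ _ c01] := face_corners (p i j.+1) (p i j.+2) (p i.+1 j.+2) (p i.+1 j.+1).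
apply: unique_relation4.
- exact: adjacent_independent3 (net _ _ _ _) (net _ _ _ _) (adj1 _ _ _ _) c00 c10.
- by apply: adjacent_independent3 (adj2 i.+1 j _ _) c10 (cornerC c11) => //; apply: net.
(* [adj1] and [adj2] put the face of smaller index first, which reverses the last two triples. *)
- apply: independent3_rev.
  by apply: adjacent_independent3 (adj1 i j.+1 _ _) c01 c11 => //; apply: net.
- apply: independent3_rev.
  by apply: adjacent_independent3 (adj2 i j _ _) (cornerC c00) c01 => //; apply: net.
Qed.

Lemma flexible_stressP m n p : conjugate_net m n p ->
  infinitesimally_flexible m n p <->
  exists h k, self_stress m n p h k /\ nonzero_stress m n h k.
Proof.
move=> net.
have edge_h i j : (i < m)%N -> (j < n)%N -> p i j.+1 != p i.+1 j.+1.
  move=> lti ltj; have [_ _ c _] := face_corners (p i j) (p i j.+1) (p i.+1 j.+1) (p i.+1 j).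
  exact: corner_neq (net i j lti ltj) c.
have edge_k i j : (i < m)%N -> (j < n)%N -> p i.+1 j.+1 != p i.+1 j.
  move=> lti ltj; have [_ _ c _] := face_corners (p i j) (p i j.+1) (p i.+1 j.+1) (p i.+1 j).
  by rewrite eq_sym; exact: corner_neq (net i j lti ltj) (cornerC c).
split=> [[xi [[iso agree1 agree2] ntriv]] | [h [k [stress nz]]]].
  (* [rb] collects the rotation vector and the translation of each face, with default 0 outside the
     grid. *)
  have /choice[rb xiE] (ij : nat * nat) : exists rb : 'cV[R]_3 * 'cV[R]_3,
      (ij.1 < m)%N -> (ij.2 < n)%N ->
      forall x, xi ij.1 ij.2 x = cross_mx rb.1 *m x + rb.2.
    have [/andP[lti ltj]|out] := boolP ((ij.1 < m) && (ij.2 < n))%N.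
      have [A [b [/skew_cross_mx[r ->] xiA]]] := iso _ _ lti ltj.
      by exists (r, b).
    by exists 0 => lti ltj; rewrite lti ltj in out.
  have jump i j i' j' u v : (i < m)%N -> (j < n)%N -> (i' < m)%N -> (j' < n)%N ->
      agree_on_segment (xi i j) (xi i' j') u v ->
      cross_mx ((rb (i', j')).1 - (rb (i, j)).1) *m (v - u) = 0 /\
      (rb (i', j')).2 - (rb (i, j)).2 =
        - (cross_mx ((rb (i', j')).1 - (rb (i, j)).1) *m u).
    move=> lti ltj lti' ltj'; rewrite [cross_mx _]linearB.
    exact: (iffLR (agree_on_segmentP u v (xiE (i, j) lti ltj) (xiE (i', j') lti' ltj'))).
  (* Edges of [h] are directed to smaller [i], those of [k] to larger [j]; the closing condition at
     a vertex then becomes the equilibrium equation with plus signs only. *)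
  have /choice[h hE] (ij : nat * nat) : exists w : R, (ij.1 < m)%N -> (ij.2.+1 < n)%N ->
      (rb (ij.1, ij.2.+1)).1 - (rb ij).1 = w *: (p ij.1 ij.2.+1 - p ij.1.+1 ij.2.+1).
    case: ij => i j /=; have [/andP[lti ltj]|out] := boolP ((i < m) && (j.+1 < n))%N;
      last by exists 0 => lti ltj; rewrite lti ltj in out.
    have [rel _] := jump _ _ _ _ _ _ lti (ltnW ltj) lti ltj (agree2 _ _ lti ltj).
    have [|a ->] := cross_mx_eq0 _ rel.
      by rewrite subr_eq0 eq_sym edge_h // ltnW.
    by exists (- a) => _ _; rewrite scaleNr -scalerN opprB.
  have /choice[k kE] (ij : nat * nat) : exists w : R, (ij.1.+1 < m)%N -> (ij.2 < n)%N ->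
      (rb (ij.1.+1, ij.2)).1 - (rb ij).1 = w *: (p ij.1.+1 ij.2.+1 - p ij.1.+1 ij.2).
    case: ij => i j /=; have [/andP[lti ltj]|out] := boolP ((i.+1 < m) && (j < n))%N;
      last by exists 0 => lti ltj; rewrite lti ltj in out.
    have [rel _] := jump _ _ _ _ _ _ (ltnW lti) ltj lti ltj (agree1 _ _ lti ltj).
    have [|a ->] := cross_mx_eq0 _ rel; last by exists a.
    by rewrite subr_eq0 edge_k // ltnW.
  exists (fun i j => h (i, j)), (fun i j => k (i, j)); split.
    move=> i j lti ltj v; have lti' := ltnW lti; have ltj' := ltnW ltj.
    have := hE (i, j) lti' ltj; have := hE (i.+1, j) lti ltj.
    have := kE (i, j) lti ltj'; have := kE (i, j.+1) lti ltj.
    rewrite -/v /= => /matrixP k1 /matrixP k0 /matrixP h1 /matrixP h0.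
    apply/matrixP=> a b; move: (k1 a b) (k0 a b) (h1 a b) (h0 a b).
    by rewrite !mxE; lra.
  apply: contrapT => zero; apply: ntriv.
  have h0 i j : (i < m)%N -> (j.+1 < n)%N -> h (i, j) = 0.
    by move=> lti ltj; apply/eqP/negP => /negP nzh; apply: zero; left; exists i, j.
  have k0 i j : (i.+1 < m)%N -> (j < n)%N -> k (i, j) = 0.
    by move=> lti ltj; apply/eqP/negP => /negP nzk; apply: zero; right; exists i, j.
  (* The rotation jump determines the translation jump, so zero weights make the motion constant
     across edges. *)
  have rb_const i j i' j' u v : (i < m)%N -> (j < n)%N -> (i' < m)%N -> (j' < n)%N ->
      agree_on_segment (xi i j) (xi i' j') u v ->
      (rb (i', j')).1 - (rb (i, j)).1 = 0 -> rb (i', j') = rb (i, j).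
    move=> lti ltj lti' ltj' /jump[] // _; move=> bE r0; move: bE.
    rewrite r0 linear0 mul0mx oppr0 => b0.
    by rewrite [LHS]surjective_pairing [RHS]surjective_pairing; congr (_, _);
       apply/eqP; rewrite -subr_eq0 ?r0 ?b0.
  have rb00 i j : (i < m)%N -> (j < n)%N -> rb (i, j) = rb (0, 0)%N.
    elim: j => [|j IHj] lti ltj.
      elim: i lti => // i IHi lti; rewrite -IHi ?(ltnW lti) //.
      apply: rb_const (agree1 _ _ lti ltj) _; rewrite ?(ltnW lti) //.
      by rewrite (kE (i, _)) // k0 ?scale0r.
    rewrite -IHj ?(ltnW ltj) //.
    apply: rb_const (agree2 _ _ lti ltj) _; rewrite ?(ltnW ltj) //.
    by rewrite (hE (i, _)) // h0 ?scale0r.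
  by move=> i j i' j' *; move=> x; rewrite (xiE (i, j)) // (xiE (i', j')) // !rb00.
have addDK (V : zmodType) (x y : V) : x + y - x = y by rewrite addrAC subrr add0r.
(* [D d v] encodes the field that sends [x] to the cross product of [d] and [x - v]: a rotation
   whose axis passes through [v]. *)
pose D (d v : 'cV[R]_3) : 'cV[R]_3 * 'cV[R]_3 := (d, - (cross_mx d *m v)).
pose F i j rb := rb + D (k i j *: (p i.+1 j.+1 - p i.+1 j)) (p i.+1 j).
pose G i j rb := rb + D (h i j *: (p i j.+1 - p i.+1 j.+1)) (p i j.+1).
(* The moment of an edge vector may be taken about either of its ends. *)
have DC (w : R) a b : D (w *: (a - b)) a = D (w *: (a - b)) b.
  congr (_, - _); apply/eqP; rewrite -subr_eq0 -mulmxBr linearZ -scalemxAl.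
  by rewrite cross_mx_self scaler0.
have DD d d' v : D d v + D d' v = D (d + d') v.
  by congr (_, _); rewrite /= linearD mulmxDl opprD.
have [|s [_ sF sG]] := @grid_transport _ m n F G 0.
  move=> i j lti ltj rb; rewrite /F /G /= -!addrA; congr (_ + _).
  (* Once all moments are taken about [p i.+1 j.+1], closing up around this vertex is exactly
     equilibrium there. *)
  rewrite -(DC _ _ (p i.+1 j)) (DC _ (p i j.+1)) !DD; congr (D _ _).
  have /matrixP stress_ij := stress i j lti ltj.
  by apply/matrixP=> a b; move: (stress_ij a b); rewrite !mxE; lra.
exists (fun i j x => cross_mx (s i j).1 *m x + (s i j).2); split; first split.
- by move=> i j _ _; exists (cross_mx (s i j).1), (s i j).2; rewrite tr_cross_mx.
- move=> i j lti ltj; apply/(agree_on_segmentP _ _ (fun=> erefl) (fun=> erefl)).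
  rewrite -(linearB (@cross_mx R)) sF //= !addDK; split=> //.
  by rewrite linearZ -scalemxAl cross_mx_self scaler0.
- move=> i j lti ltj; apply/(agree_on_segmentP _ _ (fun=> erefl) (fun=> erefl)).
  rewrite -(linearB (@cross_mx R)) sG //= !addDK; split=> //.
  by rewrite linearZ -scalemxAl -(opprB (p i j.+1)) mulmxN cross_mx_self oppr0 scaler0.
have zero_jump : trivial_deformation m n
      (fun i j x => cross_mx (s i j).1 *m x + (s i j).2) ->
    forall i j i' j', (i < m)%N -> (j < n)%N -> (i' < m)%N -> (j' < n)%N ->
    forall d v, s i' j' = s i j + D d v -> d = 0.
  move=> triv i j i' j' lti ltj lti' ltj' d v ss.
  apply: cross_mx_inj; rewrite linear0; apply/matrixP=> a b.
  have := triv i j i' j' lti ltj lti' ltj'; rewrite ss /= => eqx.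
  (* The value at 0 equates the translations, and the value at a basis vector then equates a column
     of the matrices. *)
  have b0 := eqx 0; have eqb := eqx (delta_mx b 0); move: b0 eqb.
  rewrite !mulmx0 !add0r => <-.
  rewrite linearD mulmxDl => /addIr /eqP.
  rewrite -subr_eq0 opprD addrA subrr add0r oppr_eq0 => /eqP/matrixP/(_ a 0).
  rewrite -colE !mxE; exact.
move=> triv; case: nz => [[i [j [lti ltj]]] | [i [j [lti ltj]]]] /eqP; case.
  have /eqP := zero_jump triv i j i j.+1 lti (ltnW ltj) lti ltj _ _ (sG _ _ lti ltj).
  by rewrite scaler_eq0 subr_eq0 (negbTE (edge_h _ _ lti (ltnW ltj))) orbF => /eqP.
have /eqP := zero_jump triv i j i.+1 j (ltnW lti) ltj lti ltj _ _ (sF _ _ lti ltj).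
by rewrite scaler_eq0 subr_eq0 (negbTE (edge_k _ _ (ltnW lti) ltj)) orbF => /eqP.
Qed.

End SelfStress.

(** * Gluing the stresses of the subnets *)

Theorem theorem12 (R : realType) (m n : nat) (p : nat -> nat -> 'cV[R]_3)
  (hmn : (1 < m * n)%N)
  (hnet : conjugate_net m n p)
  (hadj : no_coplanar_adjacent_faces m n p)
  (hsub : forall a b : nat, (a + 3 <= m)%N -> (b + 3 <= n)%N ->
     infinitesimally_flexible 3 3 (subnet a b p)) :
  infinitesimally_flexible m n p.
Proof.
apply/(flexible_stressP hnet).
have [/andP[m_gt1 n_gt1]|strip] := boolP ((1 < m) && (1 < n))%N; last first.
  (* A strip has no interior vertex, so all weights are in equilibrium. *)
  exists (fun _ _ => 1), (fun _ _ => 1); split=> [i j lti ltj|].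
    by rewrite (leq_ltn_trans _ lti) // (leq_ltn_trans _ ltj) in strip.
  (* By [hmn] there are at least two faces, hence a shared edge, which is of type [k] if [1 < m] and
     of type [h] otherwise. *)
  have [m_gt1|m_le1] := ltnP 1 m.
    by right; exists 0%N, 0%N; rewrite oner_eq0; split=> //; nia.
  by left; exists 0%N, 0%N; rewrite oner_eq0; split=> //; nia.
have /choice[c cE] (ij : nat * nat) : exists c : R * R * R * R,
    (ij.1.+1 < m)%N -> (ij.2.+1 < n)%N -> vertex_relation p ij.1 ij.2 c.
  have [/andP[lti ltj]|out] := boolP ((ij.1.+1 < m) && (ij.2.+1 < n))%N.
    by have [c ?] := interior_vertex_relation hnet hadj lti ltj; exists c.
  by exists (0, 0, 0, 0) => lti ltj; rewrite lti ltj in out.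
pose w i j := (c (i, j)).1.1.1; pose s i j := (c (i, j)).1.1.2.
pose e i j := (c (i, j)).1.2; pose t i j := (c (i, j)).2.
have {}cE i j : (i.+1 < m)%N -> (j.+1 < n)%N ->
    vertex_relation p i j (w i j, s i j, e i j, t i j).
  by move=> lti ltj; have := cE (i, j) lti ltj; rewrite /w /s /e /t; case: (c _) => -[[]].
(* [l i j] is the scale at the interior vertex [p i.+1 j.+1], so there are [m.-1] by [n.-1] of them.
   The factors make the two ends of an interior edge assign it the same weight. *)
have [|l [l0 lE lN]] := @grid_transport R m.-1 n.-1
    (fun i j x => e i j / w i.+1 j * x) (fun i j x => t i j / s i j.+1 * x) 1.
  move=> i j; rewrite -!ltn_predRL /= => lti ltj x /=; rewrite !mulrA.
  congr (_ * x).
  have lti' : (i.+1 < m)%N by lia.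
  have ltj' : (j.+1 < n)%N by lia.
  have lti2 : (i.+2 < m)%N by lia.
  have ltj2 : (j.+2 < n)%N by lia.
  have [[w00 s00 e00 t00] _ u00] := cE _ _ lti' ltj'.
  have [[w10 s10 e10 t10] _ u10] := cE _ _ lti2 ltj'.
  have [[w01 s01 e01 t01] _ u01] := cE _ _ lti' ltj2.
  have [[w11 s11 e11 t11] _ u11] := cE _ _ lti2 ltj2.
  (* The corners of the central face of this subnet are its four interior vertices. *)
  have net33 : conjugate_net 3 3 (subnet i j p).
    by apply: (subnet_conjugate_net hnet); rewrite addn3.
  have [||] := iffLR (flexible_stressP net33) (hsub i j _ _); rewrite ?addn3 //.
  move=> h [k [stress nz]].
  have := stress 0%N 0%N isT isT; have := stress 1%N 0%N isT isT.
  have := stress 0%N 1%N isT isT; have := stress 1%N 1%N isT isT.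
  rewrite /subnet !addnS !addn0.
  move=> /u11[l11 [hw11 hs11 he11 ht11]] /u01[l01 [hw01 hs01 he01 ht01]].
  move=> /u10[l10 [hw10 hs10 he10 ht10]] /u00[l00 [hw00 hs00 he00 ht00]].
  have l10E : l10 = l00 * e i j / w i.+1 j by rewrite -he00 hw10 mulfK.
  have l01E : l01 = l00 * t i j / s i j.+1 by rewrite -ht00 hs01 mulfK.
  have l11E : l11 = l10 * t i.+1 j / s i.+1 j.+1 by rewrite -ht10 hs11 mulfK.
  have l11E' : l11 = l01 * e i j.+1 / w i.+1 j.+1 by rewrite -he01 hw11 mulfK.
  (* If one scale vanishes, so do all four, and each of the twelve shared edges ends at one of these
     vertices. *)
  have nz00 : l00 != 0.
    apply/eqP=> l0; move: l10E l01E l11E; rewrite l0 !mul0r => l10E l01E.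
    rewrite l10E !mul0r => l11E.
    move: hw11 hs11 he11 ht11 hw01 hs01 he01 ht01 hw10 hs10 he10 ht10 hw00 hs00 he00 ht00.
    rewrite l0 l10E l01E l11E !mul0r.
    case: nz => [[[|[|[|?]]]] [[|[|?]] [? ? /eqP]] | [[|[|?]] [[|[|[|?]]] [? ? /eqP]]]] //.
  (* Both ways around the central face compute [l11] from [l00]. *)
  apply: (mulfI nz00).
  transitivity l11; first by rewrite l11E l10E; ring.
  by rewrite l11E' l01E; ring.
(* Each weight is read at the end of smaller index; for index 0 that end is on the boundary, so the
   other end is used. *)
pose h i j := if i is i'.+1 then l i' j * e i' j else l 0%N j * w 0%N j.
pose k i j := if j is j'.+1 then l i j' * t i j' else l i 0%N * s i 0%N.
have hw i j : (i.+1 < m)%N -> (j.+1 < n)%N -> h i j = l i j * w i j.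
  case: i => // i lti ltj; have [[nzw _ _ _] _ _] := cE _ _ lti ltj.
  by rewrite /h lE; [field | lia | lia].
have ks i j : (i.+1 < m)%N -> (j.+1 < n)%N -> k i j = l i j * s i j.
  case: j => // j lti ltj; have [[_ nzs _ _] _ _] := cE _ _ lti ltj.
  by rewrite /k lN; [field | lia | lia].
exists h, k; split=> [i j lti ltj /=|].
  have [_ rel _] := cE i j lti ltj.
  by rewrite hw // ks // -!scalerA -!scalerDr rel scaler0.
left; exists 0%N, 0%N; split=> //; first exact: ltnW.
have [[nzw _ _ _] _ _] := cE 0%N 0%N m_gt1 n_gt1.
by rewrite /h l0 mul1r.
Qed.
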